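(* The relation $\trianglelefteq$ on the set of Okada half arc-diagrams of rank $N$ defines a ranked (graded) join-semilattice. In it, $G\triangleleft H$ is a covering relation if and only if the Okada half arc-diagram $G$ can be obtained from $H$ by one of the following operations: (1) gluing together two propagating arcs of $H$ with consecutive labels $\ell$ and $\ell+1$ to obtain a non-propagating arc labelled $\ell$; (2) replacing the label $\ell$ by $\ell-2$ in some propagating arc of $H$ labelled $\ell$. Furthermore, the rank of $H$ in the dual poset is $$\frac12\Big(\mathrm{NP}(H)+\sum_{i=1}^N \big(i-\ell(i)\big)\Big),$$ where $\mathrm{NP}(H)$ is the number of non-propagating arcs of $H$ and $\ell(i)$ is the label of the arc of $H$ incident to node $i$. The maximal rank is $\lfloor N^2/4\rfloor$.
   Context: Okada half arc-diagram of rank $N$: a partition of $[N]=\{1,\dots,N\}$ into pairs $\{i,j\}$ (full, non-propagating arcs) and singletons $\{i\}$ (propagating half arcs), each carrying an integer label, non-crossing: no two full arcs $\{a,b\},\{c,d\}$ satisfy $a<c<b<d$, and no propagating half arc at $k$ satisfies $a<k<b$ for a full arc $\{a,b\}$. Nesting: a full arc $\{a<b\}$ is nested in a full arc $\{c<d\}$ if $c<a<b<d$; a full arc $\{a<b\}$ is nested in the half arc at $k$ if $k<a$; the half arc at $i$ is nested in the half arc at $k$ if $k<i$. The label of an arc is at least $1$, at most the smallest node of the arc, and of the same parity as this smallest node; an arc nested in another has a strictly larger label. The relation $G\trianglelefteq H$ between Okada half arc-diagrams of rank $N$ means: (1) whenever $\{i,j\}$ labelled $\ell$ is a full arc of $H$,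 it is a full arc of $G$ with the same label; (2) whenever $H$ has a propagating half arc at $i$ labelled $\ell$, the arc of $G$ incident to $i$ (propagating or not) has label at most $\ell$. One writes $G\triangleleft H$ if $G\trianglelefteq H$ and $G\neq H$. A poset is ranked (graded) if it has a function to the integers changing by exactly one along each covering relation; the rank in the dual poset is normalized so that the maximum element of $\trianglelefteq$ (the half diagram with propagating half arcs at every $i$ labelled $i$) has rank $0$. *)

(* Defs.v *)
From HB Require Import structures.
From mathcomp Require Import all_boot all_order all_algebra.

Set Implicit Arguments.
Unset Strict Implicit.
Unset Printing Implicit Defensive.

(* Nodes 1, ..., N are the elements i : 'I_N, the node number being i.+1. *)

Section Arcs.

Variable N : nat.
Implicit Types (P : {set {set 'I_N}}) (l : {ffun 'I_N -> nat}).
Implicit Types a b c d i j k : 'I_N.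

Definition full_arc P a b : bool := (a < b) && ([set a; b] \in P).

Definition half_arc P i : bool := [set i] \in P.

Definition noncrossing P : bool :=
  [forall a, forall b, full_arc P a b ==>
     [forall c, forall d, full_arc P c d ==> ~~ [&& a < c, c < b & b < d]]
     && [forall k, half_arc P k ==> ~~ (a < k < b)]].

(* The labels of the arcs are recorded on the nodes: l i is the label of the *)
(* arc incident to i. *)
Definition label_on_arcs P l : bool :=
  [forall A in P, forall i in A, forall j in A, l i == l j].

Definition label_ok (i : 'I_N) (m : nat) : bool :=
  [&& 1 <= m, m <= i.+1 & odd m == odd i.+1].

Definition labels_admissible P l : bool :=
  [forall a, forall b, full_arc P a b ==> label_ok a (l a)]
  && [forall k, half_arc P k ==> label_ok k (l k)].

(* The three conjuncts: a full arc nested in a full arc, a full arc nested   *)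
(* in a half arc, a half arc nested in a half arc. *)
Definition labels_nested P l : bool :=
  [&& [forall a, forall b, forall c, forall d,
         [&& full_arc P a b, full_arc P c d, c < a & b < d] ==> (l c < l a)],
      [forall a, forall b, forall k,
         [&& full_arc P a b, half_arc P k & k < a] ==> (l k < l a)]
    & [forall i, forall k,
         [&& half_arc P i, half_arc P k & k < i] ==> (l k < l i)]].

Definition is_okada (D : {set {set 'I_N}} * {ffun 'I_N -> nat}) : bool :=
  [&& partition D.1 [set: 'I_N],
      [forall A in D.1, (#|A| == 1) || (#|A| == 2)],
      noncrossing D.1,
      label_on_arcs D.1 D.2,
      labels_admissible D.1 D.2
    & labels_nested D.1 D.2].

End Arcs.

Record okada (N : nat) := Okada {
  okada_val :> {set {set 'I_N}} * {ffun 'I_N -> nat};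
  _ : is_okada okada_val
}.

HB.instance Definition _ (N : nat) := [isSub for @okada_val N].
HB.instance Definition _ (N : nat) := [Choice of okada N by <:].

Section Diagrams.

Variable N : nat.
Implicit Types G H : okada N.

Definition arcs H : {set {set 'I_N}} := H.1.

Definition lab H : {ffun 'I_N -> nat} := H.2.

Definition full H (i j : 'I_N) : bool := full_arc (arcs H) i j.

Definition half H (i : 'I_N) : bool := half_arc (arcs H) i.

Definition okada_le G H : Prop :=
  (forall i j, full H i j -> full G i j /\ lab G i = lab H i)
  /\ (forall i, half H i -> lab G i <= lab H i).

Definition NP H : nat := #|[set A in arcs H | #|A| == 2]|.

Definition gluing G H : Prop :=
  exists i j : 'I_N,
    [/\ half H i, half H j, lab H j = (lab H i).+1,
        arcs G = [set i; j] |: (arcs H :\ [set i] :\ [set j])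
      & forall k, lab G k = if k \in [set i; j] then lab H i else lab H k].

(* Stated additively because subtraction on nat is truncated. *)
Definition lowering G H : Prop :=
  exists i : 'I_N,
    [/\ half H i, arcs G = arcs H, lab H i = lab G i + 2
      & forall k, k != i -> lab G k = lab H k].

End Diagrams.

Lemma okada_top_subproof (N : nat) :
  is_okada ([set [set i] | i : 'I_N], [ffun i : 'I_N => i.+1]).
Proof.
have nofull (a b : 'I_N) : full_arc [set [set i] | i : 'I_N] a b = false.
  apply/negP => /andP[ab /imsetP[i _ /setP e]].
  have /esym := e a; have /esym := e b; rewrite !inE !eqxx orbT /=.
  by move=> /eqP eb /eqP ea; rewrite ea eb ltnn in ab.
apply/and5P; split => /=.
- apply/and3P; split.
  + apply/eqP/setP => x; rewrite inE; apply/bigcupP.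
    by exists [set x]; rewrite ?set11 // imset_f.
  + apply/trivIsetP => A B /imsetP[i _ ->] /imsetP[j _ ->] ij.
    by rewrite disjoints1 inE; apply: contraNneq ij => ->.
  + by apply/imsetP => -[i _ /setP/(_ i)]; rewrite !inE eqxx.
- by apply/forall_inP => A /imsetP[i _ ->]; rewrite cards1.
- by apply/forallP => a; apply/forallP => b; rewrite nofull.
- apply/forall_inP => A /imsetP[i _ ->].
  apply/forall_inP => x /set1P ->.
  by apply/forall_inP => y /set1P ->.
- apply/andP; split.
    apply/andP; split.
      by apply/forallP => a; apply/forallP => b; rewrite nofull.
    by apply/forallP => k; apply/implyP => _; rewrite ffunE /label_ok leqnn eqxx.
  apply/and3P; split.
  + by do 4! [apply/forallP => ?]; rewrite nofull.
  + by do 3! [apply/forallP => ?]; rewrite nofull.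
  + apply/forallP => i; apply/forallP => k; apply/implyP => /and3P[_ _ ki].
    by rewrite !ffunE ltnS.
Qed.

Definition okada_top (N : nat) : okada N := Okada (okada_top_subproof N).

Section Posets.

Variables (T : Type) (le : T -> T -> Prop).

Definition partial_order : Prop :=
  [/\ forall x, le x x,
      forall x y, le x y -> le y x -> x = y
    & forall x y z, le x y -> le y z -> le x z].

Definition is_join (x y z : T) : Prop :=
  [/\ le x z, le y z & forall w, le x w -> le y w -> le z w].

Definition join_semilattice : Prop :=
  partial_order /\ forall x y, exists z, is_join x y z.

Definition strict (x y : T) : Prop := le x y /\ x <> y.

(* y covers x *)
Definition covers (x y : T) : Prop :=
  strict x y /\ ~ exists z, strict x z /\ strict z y.

Definition rank_function (rk : T -> int) : Prop :=
  forall x y, covers x y -> rk y = (rk x + 1)%R.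

Definition ranked : Prop := exists rk, rank_function rk.

End Posets.

Definition dual_rel (T : Type) (le : T -> T -> Prop) : T -> T -> Prop :=
  fun x y => le y x.

(* Main.v *)
Require Import Defs.
From mathcomp Require Import all_boot all_order all_algebra.
From mathcomp Require Import zify.
Import Order.TTheory GRing.Theory Num.Theory.
(* [half] must denote half arcs, not halving of natural numbers. *)
Import Defs.

Set Implicit Arguments.
Unset Strict Implicit.
Unset Printing Implicit Defensive.

(** A diagram is an involution of the nodes together with a labelling, and
[G <= H] implies that the labels of [G] are pointwise at most those of [H]
([okada_le_lab]).  Equality of all labels forces [G = H], since gluing two half
arcs identifies two labels that were distinct ([okada_le_lab_eq]); antisymmetry
follows.

Joins.  Two diagrams [U] and [V] with a common lower bound [G] have a meet
([okada_meet]): its full arcs are those of [U] and those of [V], and its labels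
are the pointwise minima.  This is a diagram because all these full arcs occur
in [G] with the same labels, and a minimum of two strictly increasing sequences
of half-arc labels is strictly increasing.  The set of diagrams is finite and has
a top, so the join of two diagrams is the meet of all their upper bounds
([okada_join]).

Covers and rank.  Everything rests on [exists_move]: if [G < H], then some gluing
or lowering [K] of [H] satisfies [G <= K]; it is found at the first node where
the labels of [G] and [H] differ.  Each such move increases
[NP H + \sum_i (i - l i)] by exactly 2 ([twice_rank_move]), this quantity is
bounded by [N ^ 2 / 2], and so every [G <= H] is reached from [H] by finitely many
moves ([move_ind]).  Hence moves are exactly the covers, and any rank function
vanishing at the top is half of this quantity.

Maximal rank.  As all labels are at least 1 and there are at most [N / 2] full
arcs, twice the rank is at most [N / 2 + N (N - 1) / 2 = N ^ 2 / 2]; pairing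
adjacent nodes and giving every arc the label 1 reaches this bound up to rounding. *)

(** * Counting with an involution *)

(** For the set of nodes under a full arc this gives the parity of its ends; for the
set of all nodes it gives the number of full arcs of a diagram. *)
Lemma card_involution N (f : 'I_N -> 'I_N) (S : {set 'I_N}) :
  involutive f -> (forall x, x \in S -> f x \in S) ->
  #|S| = 2 * #|[set x in S | x < f x]| + #|[set x in S | f x == x]|.
Proof.
move=> fK fS; set O := [set x in S | x < f x]; set F := [set x in S | f x == x].
have cardC : #|[set x in S | f x < x]| = #|O|.
  rewrite -(card_imset (mem O) (inv_inj fK)); apply: eq_card => y; apply/idP/imsetP.
    by rewrite inE => /andP[yS fy]; exists (f y); rewrite ?fK // !inE fS // fK.
  by case=> x; rewrite !inE => /andP[xS xf] ->; rewrite fS // fK.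
rewrite -(cardsID O S) -(cardsID F (S :\: O)) mul2n -addnn -[in RHS]addnA.
congr (_ + _); first by apply: eq_card => x; rewrite !inE; case: (x \in S).
rewrite -cardC addnC; congr (_ + _); apply: eq_card => x; rewrite !inE -!val_eqE /=;
  by case: (x \in S) => //=; case: ltngtP.
Qed.

Lemma card_ord_between N (a b : 'I_N) :
  a < b -> #|[set c : 'I_N | a < c < b]| = b - a.+1.
Proof.
move=> ab; rewrite -sum1_card -[RHS]muln1 -sum_nat_const_nat.
rewrite (big_nat_widen _ _ N) /=; last by rewrite ltnW.
rewrite (big_nat_widenl _ 0) //= big_mkord; apply: eq_bigl => c.
by rewrite inE andbC.
Qed.

(** * Diagrams as labelled involutions *)

(** The pairs and singletons of a diagram are the orbits of an involution [f]
of the nodes, fixed points being the half arcs.  In this form a single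
implication expresses that nothing crosses a full arc, and a single one covers
the three kinds of nesting: [y] opens an arc nested in the arc of [x] as soon as
[x < y] and the arc of [x] is a half arc or is still open at [y]. *)
Record arch_system N (f : 'I_N -> 'I_N) (l : 'I_N -> nat) : Prop := ArchSystem {
  arch_invol : involutive f;
  arch_noncrossing : forall a c : 'I_N, a < c -> c < f a -> (f c != c) && (a < f c < f a);
  arch_label : forall x, l (f x) = l x;
  arch_label_ok : forall x : 'I_N, x <= f x -> label_ok x (l x);
  arch_nested :
    forall x y : 'I_N, y <= f y -> x < y -> (f x == x) || (y < f x) -> l x < l y }.

(** The nodes strictly under a full arc are paired among themselves, so their
number is even. *)
Lemma arch_parity N (f : 'I_N -> 'I_N) l :
  arch_system f l -> forall a : 'I_N, a < f a -> odd (f a) = ~~ odd a.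
Proof.
move=> fl a afa; set S := [set c : 'I_N | a < c < f a].
have fS x : x \in S -> (f x != x) && (f x \in S).
  by rewrite !inE => /andP[]; apply: (arch_noncrossing fl).
have /(congr1 odd) := card_involution (arch_invol fl) (fun x xS => proj2 (andP (fS x xS))).
rewrite card_ord_between // oddD mul2n odd_double /=.
rewrite (_ : [set x in S | f x == x] = set0) ?cards0.
  by rewrite oddB //=; case: (odd a); case: (odd _).
by apply/setP => x; rewrite inE in_set0; apply/negP => /andP[/fS/andP[/negP]].
Qed.

Section Mate.

Variable N : nat.
Implicit Types (P : {set {set 'I_N}}) (H : okada N).

(** The other element of the block of [x], or [x] itself in a singleton. *)
Definition partner P x : 'I_N := odflt x [pick y in pblock P x :\ x].

Lemma arc_partner P A x :
    partition P [set: 'I_N] -> [forall B in P, (#|B| == 1) || (#|B| == 2)] ->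
  A \in P -> x \in A -> A = [set x; partner P x].
Proof.
move=> /and3P[_ tiP _] cardP AP xA; rewrite /partner (def_pblock tiP AP xA).
case: pickP => [y /setD1P[yx yA]|noy] /=.
  apply/esym/eqP; rewrite eqEcard cards2 eq_sym yx; apply/andP; split.
    by apply/subsetP => z /set2P[] ->.
  by case/orP: (forall_inP cardP A AP) => /eqP->.
by apply/setP => y; have := noy y; rewrite !inE orbb; case: eqP => // ->.
Qed.

Definition mate H : 'I_N -> 'I_N := partner (arcs H).

Lemma okadaP H : is_okada (okada_val H).
Proof. exact: valP. Qed.

Lemma arcs_partition H : partition (arcs H) [set: 'I_N].
Proof. by case/and5P: (okadaP H). Qed.

Lemma arc_mate H A x : A \in arcs H -> x \in A -> A = [set x; mate H x].
Proof. by apply: arc_partner; case/and5P: (okadaP H). Qed.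

Lemma mem_arcs H x : [set x; mate H x] \in arcs H.
Proof.
have : x \in cover (arcs H) by rewrite (cover_partition (arcs_partition H)) in_setT.
by case/bigcupP => A AP xA; rewrite -(arc_mate AP xA).
Qed.

End Mate.

Section Orbits.

Variable N : nat.
Implicit Types (f : 'I_N -> 'I_N) (l : 'I_N -> nat) (G H : okada N) (a b c k x y : 'I_N).

(** For an involution [f], the blocks of the corresponding set partition. *)
Definition orbits f : {set {set 'I_N}} := [set [set x; f x] | x : 'I_N].

Lemma orbit_mem f A x :
  involutive f -> A \in orbits f -> x \in A -> A = [set x; f x].
Proof.
by move=> fK /imsetP[y _ ->] /set2P[]-> //; rewrite fK setUC.
Qed.

Lemma full_arc_orbits f a b :
  involutive f -> full_arc (orbits f) a b = (a < b) && (f a == b).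
Proof.
move=> fK; rewrite /full_arc; case: ltnP => //= ab; apply/idP/eqP => [abf|<-].
  have /setP/(_ b) := orbit_mem fK abf (set21 a b).
  by rewrite !inE eqxx orbT; case: eqP ab => [->|_ _ /esym/eqP->]; rewrite ?ltnn.
exact: imset_f.
Qed.

Lemma half_arc_orbits f x : involutive f -> half_arc (orbits f) x = (f x == x).
Proof.
move=> fK; apply/idP/eqP => [xf|fx].
  have /setP/(_ (f x)) := orbit_mem fK xf (set11 x).
  by rewrite !inE eqxx orbT => /eqP.
by apply/imsetP; exists x; rewrite // fx setUid.
Qed.

Lemma mateK H : involutive (mate H).
Proof.
move=> x; have := arc_mate (mem_arcs H x) (set22 x _) => /setP/(_ x).
by rewrite !inE eqxx /=; case: eqP => [e _|_ /esym/eqP]; rewrite -?e.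
Qed.

Lemma arcs_orbits H : arcs H = orbits (mate H).
Proof.
apply/setP => A; apply/idP/imsetP => [AP|[x _ ->]]; last exact: mem_arcs.
have [A0|[x xA]] := set_0Vmem A; last by exists x => //; apply: arc_mate.
by have /and3P[_ _ /negP[]] := arcs_partition H; rewrite -A0.
Qed.

Lemma fullE H a b : full H a b = (a < b) && (mate H a == b).
Proof. by rewrite /full arcs_orbits full_arc_orbits //; exact: mateK. Qed.

Lemma halfE H x : half H x = (mate H x == x).
Proof. by rewrite /half arcs_orbits half_arc_orbits //; exact: mateK. Qed.

(** With [is_okada_orbits] below, this makes diagrams and arch systems the same thing.
The work is in the noncrossing condition, where the position of the other end
[mate H c] has to be deduced from conditions on full arcs given by their left ends. *)
Lemma okada_arch_system H : arch_system (mate H) (lab H).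
Proof.
have fE a : a < mate H a -> full H a (mate H a) by rewrite fullE eqxx andbT.
have hE a : mate H a = a -> half H a by rewrite halfE => ->.
case/and5P: (okadaP H) => _ _ /forallP nc lA /andP[/andP[/forallP lf /forallP lh]].
case/and3P=> /forallP nff /forallP nfh /forallP nhh.
have ncf a c : a < mate H a -> c < mate H c -> ~~ [&& a < c, c < mate H a & mate H a < mate H c].
  move=> /fE fa /fE fc; have /forallP/(_ (mate H a))/implyP/(_ fa)/andP[/forallP/(_ c)] := nc a.
  by move=> /forallP/(_ (mate H c))/implyP/(_ fc).
have nch a k : a < mate H a -> mate H k = k -> ~~ (a < k < mate H a).
  move=> /fE fa /hE hk; have /forallP/(_ (mate H a))/implyP/(_ fa)/andP[_ /forallP/(_ k)] := nc a.
  by move/implyP/(_ hk).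
have noncr a c : a < c -> c < mate H a -> (mate H c != c) && (a < mate H c < mate H a).
  move=> ac ca; have afa := ltn_trans ac ca.
  have mc : mate H c != c.
    by apply/negP => /eqP /(nch _ _ afa); rewrite ac ca.
  have nea : mate H c != a by apply: contraTneq ca => <-; rewrite mateK ltnn.
  have neb : mate H c != mate H a by rewrite (inj_eq (inv_inj (@mateK H))) -val_eqE gtn_eqF.
  rewrite mc /=; have [cm|mcc|/val_inj e] := ltngtP (c : nat) (mate H c).
  - have := ncf a c afa cm; rewrite ac ca /= -leqNgt (ltn_trans ac cm) /=.
    by rewrite leq_eqVlt val_eqE (negPf neb).
  - rewrite (ltn_trans mcc ca) andbT ltnNge leq_eqVlt val_eqE (negPf nea) /=.
    apply/negP => ma; have := ncf (mate H c) a; rewrite mateK => /(_ mcc afa).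
    by rewrite ma ac ca.
  - by rewrite -e eqxx in mc.
split=> //.
- exact: mateK.
- move=> x; have /forall_inP/(_ _ (mem_arcs H x))/forall_inP/(_ (mate H x)) := lA.
  by move=> /(_ (set22 _ _))/forall_inP/(_ x (set21 _ _))/eqP.
- move=> x; rewrite leq_eqVlt => /orP[/eqP/val_inj/esym/hE hx|/fE fx].
    by have /implyP := lh x; apply.
  by have /forallP/(_ (mate H x))/implyP := lf x; apply.
- move=> x y; rewrite leq_eqVlt => /orP[/eqP/val_inj/esym ey|yfy] xy xh.
    have xx : mate H x = x.
      apply/eqP; case/orP: xh => // yx; have := noncr x y xy yx.
      by rewrite ey eqxx.
    have /forallP/(_ x)/implyP := nhh y; apply; apply/and3P; split=> //; exact: hE.
  case: eqP xh => [xx _|_ yx].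
    have /forallP/(_ (mate H y))/forallP/(_ x)/implyP := nfh y; apply.
    by apply/and3P; split=> //; [apply: fE | apply: hE].
  have /forallP/(_ (mate H y))/forallP/(_ x)/forallP/(_ (mate H x))/implyP := nff y; apply.
  apply/and4P; split=> //; try exact: fE; first by apply: fE; apply: ltn_trans yx.
  by case/and3P: (noncr x y xy yx).
Qed.

Lemma is_okada_orbits f l :
  arch_system f l -> is_okada (orbits f, [ffun x => l x]).
Proof.
move=> fl; have fK := arch_invol fl.
have fE a b : full_arc (orbits f) a b -> (a < f a) /\ f a = b.
  by rewrite full_arc_orbits // => /andP[ab /eqP ->].
apply/and5P; split=> /=.
- apply/and3P; split.
  + apply/eqP/setP => x; rewrite in_setT; apply/bigcupP.
    by exists [set x; f x]; [apply: imset_f | apply: set21].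
  + apply/trivIsetP => A B Af Bf; apply: contraNT => /pred0Pn[x /andP[xA xB]].
    by rewrite (orbit_mem fK Af xA) -(orbit_mem fK Bf xB).
  + by apply/imsetP => -[x _ /setP/(_ x)]; rewrite !inE eqxx.
- by apply/forall_inP => A /imsetP[x _ ->]; rewrite cards2; case: (_ != _).
- apply/forallP => a; apply/forallP => b; apply/implyP => /fE[afa <-].
  apply/andP; split.
    apply/forallP => c; apply/forallP => d; apply/implyP => /fE[cfc <-].
    apply/negP => /and3P[ac ca aca]; have /and3P[_ _] := arch_noncrossing fl ac ca.
    by rewrite ltnNge ltnW.
  apply/forallP => k; apply/implyP; rewrite half_arc_orbits // => fk.
  by apply/negP => /andP[ak ka]; case/andP: (arch_noncrossing fl ak ka); rewrite fk.
- apply/forall_inP => A /imsetP[x _ ->]; apply/forall_inP => y yx.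
  apply/forall_inP => z zx; rewrite !ffunE.
  by case/set2P: yx => ->; case/set2P: zx => ->; rewrite ?(arch_label fl).
- apply/andP; split.
    apply/andP; split.
      apply/forallP => a; apply/forallP => b; apply/implyP => /fE[afa _].
      by rewrite ffunE (arch_label_ok fl) // ltnW.
    apply/forallP => k; apply/implyP; rewrite half_arc_orbits // => /eqP fk.
    by rewrite ffunE (arch_label_ok fl) // fk.
  apply/and3P; split.
  + do 4![apply/forallP => ?]; apply/implyP => /and4P[/fE[? <-] /fE[? <-] ? lt].
    rewrite !ffunE (arch_nested fl) //; first exact: ltnW.
    by rewrite (ltn_trans _ lt) ?orbT.
  + do 3![apply/forallP => ?]; apply/implyP => /and3P[/fE[? _]].
    rewrite half_arc_orbits // => fk ?.
    by rewrite !ffunE (arch_nested fl) ?fk //; exact: ltnW.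
  + do 2![apply/forallP => ?]; apply/implyP => /and3P[].
    rewrite !half_arc_orbits // => /eqP fi fk ?.
    by rewrite !ffunE (arch_nested fl) ?fk ?fi.
Qed.

Definition diagram f l (fl : arch_system f l) : okada N := Okada (is_okada_orbits fl).

Lemma mate_diagram f l (fl : arch_system f l) : mate (diagram fl) =1 f.
Proof.
move=> x; set H := diagram fl.
have : [set x; f x] \in arcs H by apply: imset_f.
move/arc_mate => /(_ x (set21 _ _))/setP e.
have := e (f x); have := e (mate H x); rewrite !inE !eqxx !orbT.
by case: eqP => [-> _|_ /= /eqP//]; case: eqP => //= _ /esym /eqP.
Qed.

Lemma lab_diagram f l (fl : arch_system f l) : lab (diagram fl) =1 l.
Proof. by move=> x; rewrite /lab ffunE. Qed.

Lemma okada_eq G H : mate G =1 mate H -> lab G =1 lab H -> G = H.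
Proof.
move=> eqm eql; apply: val_inj; rewrite [LHS]surjective_pairing [RHS]surjective_pairing.
congr (_, _); last exact/ffunP.
rewrite -/(arcs G) -/(arcs H) !arcs_orbits.
by apply: eq_imset => x; rewrite eqm.
Qed.

End Orbits.

(** * The order and its joins *)

Section OkadaOrder.

Variable N : nat.
Implicit Types (G H K U V : okada N) (x y : 'I_N).

Lemma okada_le_full G H x :
  okada_le G H -> mate H x != x -> mate G x = mate H x /\ lab G x = lab H x.
Proof.
case=> GH _ Hx; have [xm|mx|/val_inj e] := ltngtP (x : nat) (mate H x).
- have [] := GH x (mate H x); first by rewrite fullE xm eqxx.
  by rewrite fullE => /andP[_ /eqP].
- have [] := GH (mate H x) x; first by rewrite fullE mateK mx eqxx.
  rewrite fullE => /andP[_ /eqP e] le.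
  have e' : mate G x = mate H x by rewrite -[in LHS]e mateK.
  by rewrite -(arch_label (okada_arch_system G)) e' le (arch_label (okada_arch_system H)).
- by rewrite -e eqxx in Hx.
Qed.

Lemma okada_le_lab G H x : okada_le G H -> lab G x <= lab H x.
Proof.
move=> GH; have [Hx|/(okada_le_full GH)[_ ->] //] := eqVneq (mate H x) x.
by case: GH => _; apply; rewrite halfE Hx.
Qed.

Lemma okada_leI G H :
    (forall x, x < mate H x -> mate G x = mate H x) ->
    (forall x, x < mate H x -> lab G x = lab H x) ->
    (forall x, mate H x = x -> lab G x <= lab H x) ->
  okada_le G H.
Proof.
move=> eqm eql lel; split=> [x y|x]; last by rewrite halfE => /eqP /lel.
rewrite !fullE => /andP[xy /eqP e].
by rewrite xy eqm ?eql e ?eqxx.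
Qed.

Lemma half_lab_lt H x y :
  mate H x = x -> mate H y = y -> x < y -> lab H x < lab H y.
Proof.
by move=> mx my xy; apply: (arch_nested (okada_arch_system H)); rewrite ?mx ?my ?eqxx.
Qed.

(** Equal labels already exclude any new full arc in [G]: it would join two half arcs
of [H], whose labels are distinct. *)
Lemma okada_le_lab_eq G H : okada_le G H -> lab G =1 lab H -> G = H.
Proof.
move=> GH eql; apply: okada_eq => // x.
have [Hx|/(okada_le_full GH)[] //] := eqVneq (mate H x) x.
apply/eqP; rewrite Hx; apply/negPn/negP => Gx.
have Hy : mate H (mate G x) = mate G x.
  apply/eqP/negPn/negP => Hy; have [e _] := okada_le_full GH Hy.
  by move: Gx; rewrite -(mateK H (mate G x)) -e mateK Hx eqxx.
have eqxy : lab H x = lab H (mate G x).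
  by rewrite -!eql (arch_label (okada_arch_system G)).
have [lt|lt|/val_inj e] := ltngtP (x : nat) (mate G x).
- by have := half_lab_lt Hx Hy lt; rewrite eqxy ltnn.
- by have := half_lab_lt Hy Hx lt; rewrite eqxy ltnn.
- by rewrite -e eqxx in Gx.
Qed.

Lemma okada_le_trans G H K : okada_le G H -> okada_le H K -> okada_le G K.
Proof.
move=> GH HK; apply: okada_leI => x.
- move=> xK; have Kx : mate K x != x by rewrite -val_eqE gtn_eqF.
  have [e _] := okada_le_full HK Kx; rewrite -e.
  by apply: (proj1 (okada_le_full GH _)); rewrite e.
- move=> xK; have Kx : mate K x != x by rewrite -val_eqE gtn_eqF.
  have [e <-] := okada_le_full HK Kx.
  by apply: (proj2 (okada_le_full GH _)); rewrite e.
- by move=> _; apply: leq_trans (okada_le_lab x HK); apply: okada_le_lab.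
Qed.

Lemma okada_partial_order : partial_order (@okada_le N).
Proof.
split; [by [] | | exact: okada_le_trans].
move=> G H GH HG; apply: (okada_le_lab_eq GH) => x.
by apply/eqP; rewrite eqn_leq !okada_le_lab.
Qed.

Lemma okada_le_top H : okada_le H (okada_top N).
Proof.
have mtop x : mate (okada_top N) x = x.
  by apply/eqP; rewrite -halfE; apply: imset_f.
apply: okada_leI => x; rewrite mtop ?ltnn // => _.
rewrite /(lab (okada_top N)) ffunE /=.
have [xm|mx] := leqP x (mate H x).
  by case/and3P: (arch_label_ok (okada_arch_system H) xm).
rewrite -(arch_label (okada_arch_system H)).
have := @arch_label_ok _ _ _ (okada_arch_system H) (mate H x).
rewrite mateK => /(_ (ltnW mx)) /and3P[_ le _].
by apply: leq_trans le _; apply: ltnW.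
Qed.

End OkadaOrder.

Section Meet.

Variable N : nat.
Implicit Types (G H K U V : okada N) (x y : 'I_N).

(** If [x] is on a full arc of both [U] and [V] and these have a common lower bound,
both give it the same mate, so the choice made here is symmetric. *)
Definition meet_mate U V x := if mate U x == x then mate V x else mate U x.
Definition meet_lab U V x := minn (lab U x) (lab V x).

Lemma meet_mateC G U V x :
  okada_le G U -> okada_le G V -> meet_mate U V x = meet_mate V U x.
Proof.
move=> GU GV; rewrite /meet_mate.
have [Ux|Ux] := eqVneq (mate U x) x; have [Vx|Vx] := eqVneq (mate V x) x;
  rewrite ?Ux ?Vx //.
by rewrite -(proj1 (okada_le_full GU Ux)) -(proj1 (okada_le_full GV Vx)).
Qed.

Lemma meet_full G U V x :
    okada_le G U -> okada_le G V -> meet_mate U V x != x ->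
  meet_mate U V x = mate G x /\ meet_lab U V x = lab G x.
Proof.
rewrite /meet_mate /meet_lab => GU GV.
case: (eqVneq (mate U x) x) => [_ Vx|Ux _].
  have [-> e] := okada_le_full GV Vx; split=> //.
  by rewrite -e; apply/minn_idPr; apply: okada_le_lab.
have [-> e] := okada_le_full GU Ux; split=> //.
by rewrite -e; apply/minn_idPl; apply: okada_le_lab.
Qed.

Lemma meet_halfP U V x :
  meet_mate U V x = x -> mate U x = x /\ mate V x = x.
Proof. by rewrite /meet_mate; case: (eqVneq (mate U x) x) => // Ux /eqP; rewrite (negPf Ux). Qed.

Lemma meet_arch_system G U V :
  okada_le G U -> okada_le G V -> arch_system (meet_mate U V) (meet_lab U V).
Proof.
move=> GU GV.
have full x := @meet_full G U V x GU GV.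
have fK : involutive (meet_mate U V).
  move=> x; rewrite /meet_mate; case: (eqVneq (mate U x) x) => Ux.
    case: (eqVneq (mate U (mate V x)) (mate V x)) => UVx; first exact: mateK.
    have e := proj1 (okada_le_full GU UVx).
    case: (eqVneq (mate V x) x) => [Vx|Vx]; first by rewrite Vx.
    by rewrite -e -(proj1 (okada_le_full GV Vx)) mateK.
  by rewrite !mateK eq_sym (negPf Ux).
have lE x : meet_mate U V x != x -> meet_lab U V x = lab G x by case/full.
have aG := okada_arch_system G; have aU := okada_arch_system U; have aV := okada_arch_system V.
have ncross (a c : 'I_N) : a < c -> c < meet_mate U V a ->
    (meet_mate U V c != c) && (a < meet_mate U V c < meet_mate U V a).
  move=> ac ca; have Wa : meet_mate U V a != a by rewrite -val_eqE gtn_eqF ?(ltn_trans ac).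
  have Wc : meet_mate U V c != c.
    apply/eqP => /meet_halfP[Uc Vc]; move: ca; rewrite /meet_mate; case: eqP => _ ca.
      by have := arch_noncrossing aV ac ca; rewrite Vc eqxx.
    by have := arch_noncrossing aU ac ca; rewrite Uc eqxx.
  rewrite Wc; move: ca; rewrite (proj1 (full _ Wa)) (proj1 (full _ Wc)) => ca.
  by case/andP: (arch_noncrossing aG ac ca).
split=> //.
- move=> x; have [->//|Wx] := eqVneq (meet_mate U V x) x.
  rewrite !lE // ?fK 1?eq_sym // (proj1 (full _ Wx)).
  exact: (arch_label aG).
- move=> x; have [Wx _|Wx] := eqVneq (meet_mate U V x) x.
    have [Ux Vx] := meet_halfP Wx; rewrite /meet_lab /minn.
    by case: ifP => _; [apply: (arch_label_ok aU) | apply: (arch_label_ok aV)];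
      rewrite ?Ux ?Vx.
  by rewrite lE // (proj1 (full _ Wx)); apply: (arch_label_ok aG).
- move=> x y yW xy xW.
  have [Wx|Wx] := eqVneq (meet_mate U V x) x.
    have [Ux Vx] := meet_halfP Wx.
    have [Wy|Wy] := eqVneq (meet_mate U V y) y.
      have [Uy Vy] := meet_halfP Wy.
      rewrite /meet_lab leq_min !gtn_min.
      by rewrite (half_lab_lt Ux Uy xy) (half_lab_lt Vx Vy xy) orbT.
    have [eW lW] := full _ Wy; rewrite lW; rewrite eW in yW.
    move: Wy; rewrite /meet_lab gtn_min /meet_mate.
    case: (eqVneq (mate U y) y) => [_ Vy|Uy _].
      have [eV ->] := okada_le_full GV Vy; apply/orP; right.
      by apply: (arch_nested aV); rewrite -?eV ?Vx ?eqxx.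
    have [eU ->] := okada_le_full GU Uy; apply/orP; left.
    by apply: (arch_nested aU); rewrite -?eU ?Ux ?eqxx.
  move: xW; rewrite (negPf Wx) /= => yx; have /andP[Wy _] := ncross _ _ xy yx.
  rewrite !lE //; apply: (arch_nested aG) => //.
    by rewrite -(proj1 (full _ Wy)).
  by rewrite -(proj1 (full _ Wx)) yx orbT.
Qed.

(** The full arcs of [U] and [V] all occur in [G] with the same labels, so they are
compatible with each other; and since the labels of [G] are at most those of [U] and
[V], the label of such an arc already is the smaller of the two. *)
Lemma okada_meet G U V :
    okada_le G U -> okada_le G V ->
  exists W, [/\ okada_le W U, okada_le W V
    & forall K, okada_le K U -> okada_le K V -> okada_le K W].
Proof.
move=> GU GV; have aW := meet_arch_system GU GV; exists (diagram aW).
have mW := mate_diagram aW; have lW := lab_diagram aW.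
have below K : okada_le G K -> (forall x, mate K x != x -> meet_mate U V x != x) ->
    (forall x, meet_lab U V x <= lab K x) -> okada_le (diagram aW) K.
  move=> GK fullK labK; apply: okada_leI => x; rewrite ?mW ?lW // => xK;
    have Kx : mate K x != x by rewrite -val_eqE gtn_eqF.
  - by rewrite (proj1 (meet_full GU GV (fullK _ Kx))) (proj1 (okada_le_full GK Kx)).
  - by rewrite (proj2 (meet_full GU GV (fullK _ Kx))) (proj2 (okada_le_full GK Kx)).
split.
- apply: below => // x; last exact: geq_minl.
  by move=> Ux; rewrite /meet_mate (negPf Ux).
- apply: below => // x; last exact: geq_minr.
  by move=> Vx; rewrite (meet_mateC _ GU GV) /meet_mate (negPf Vx).
- move=> K KU KV; apply: okada_leI => x; rewrite ?mW ?lW => xW.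
  + move: xW; rewrite /meet_mate; case: (eqVneq (mate U x) x) => [_|Ux] xW.
      by apply: (proj1 (okada_le_full KV _)); rewrite -val_eqE gtn_eqF.
    exact: (proj1 (okada_le_full KU Ux)).
  + have Wx : meet_mate U V x != x by rewrite -val_eqE gtn_eqF.
    rewrite (proj2 (meet_full GU GV Wx)); move: Wx; rewrite /meet_mate.
    case: (eqVneq (mate U x) x) => [_ Vx|Ux _].
      by rewrite (proj2 (okada_le_full KV Vx)) (proj2 (okada_le_full GV Vx)).
    by rewrite (proj2 (okada_le_full KU Ux)) (proj2 (okada_le_full GU Ux)).
  + by rewrite leq_min !okada_le_lab.
Qed.

Lemma okada_le_dec G H : decidable (okada_le G H).
Proof.
pose full_ok x := (x < mate H x) ==> (mate G x == mate H x) && (lab G x == lab H x).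
apply: (@decP _ [forall x, full_ok x && (lab G x <= lab H x)]).
apply: (iffP forallP) => [GH|GH x].
  apply: okada_leI => x xH; have /andP[/implyP fx lx] := GH x => //.
    by have /andP[/eqP] := fx xH.
  by have /andP[_ /eqP] := fx xH.
rewrite (okada_le_lab _ GH) andbT; apply/implyP => xH.
have Hx : mate H x != x by rewrite -val_eqE gtn_eqF.
by have [-> ->] := okada_le_full GH Hx; rewrite !eqxx.
Qed.

(** Labels are at most [N], so the diagrams can be listed. *)
Lemma okada_finite : exists s : seq (okada N), forall H, H \in s.
Proof.
exists (pmap insub [seq (p.1, [ffun x => nat_of_ord (p.2 x)])
                   | p : {set {set 'I_N}} * {ffun 'I_N -> 'I_N.+1}]) => H.
rewrite mem_pmap_sub; apply/imageP.
exists (arcs H, [ffun x => inord (lab H x)]) => //=.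
rewrite [LHS]surjective_pairing; congr (_, _); apply/ffunP => x.
rewrite !ffunE inordK // ltnS; apply: leq_trans (okada_le_lab x (okada_le_top H)) _.
by rewrite /lab ffunE.
Qed.

(** Meets of pairs with a common lower bound give joins, because there are finitely
many diagrams and the top is an upper bound of every pair: the join is the meet of
all the upper bounds. *)
Lemma okada_join G1 G2 : exists J, is_join (@okada_le N) G1 G2 J.
Proof.
have [s sP] := okada_finite.
suff [J [J1 J2 Jmin]] : exists J, [/\ okada_le G1 J, okada_le G2 J
    & forall V, V \in s -> okada_le G1 V -> okada_le G2 V -> okada_le J V].
  by exists J; split=> // V; apply: Jmin; apply: sP.
elim: s {sP} => [|V s [J [J1 J2 Jmin]]].
  by exists (okada_top N); split=> //; apply: okada_le_top.
have [V1|nV1] := okada_le_dec G1 V; last first.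
  by exists J; split=> // U; rewrite inE => /predU1P[->|] //; apply: Jmin.
have [V2|nV2] := okada_le_dec G2 V; last first.
  by exists J; split=> // U; rewrite inE => /predU1P[->|] //; apply: Jmin.
have [W [WJ WV Wmax]] := okada_meet J1 V1.
exists W; split; [exact: Wmax | exact: Wmax | move=> U].
rewrite inE => /predU1P[->|Us] // U1 U2.
by apply: okada_le_trans WJ _; apply: Jmin.
Qed.

Lemma okada_join_semilattice : join_semilattice (@okada_le N).
Proof. by split; [apply: okada_partial_order | apply: okada_join]. Qed.

End Meet.

(** * Gluing and lowering *)

Section Moves.

Variable N : nat.
Implicit Types (G H K : okada N) (a c x y i j k : 'I_N).

Lemma no_half_below_full H a k : mate H k = k -> a < k -> ~~ (k < mate H a).
Proof.
move=> Hk ak; apply/negP => ka.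
by have := arch_noncrossing (okada_arch_system H) ak ka; rewrite Hk eqxx.
Qed.

Lemma lab_gt0 H x : 0 < lab H x.
Proof.
have aH := okada_arch_system H.
have [xm|mx] := leqP x (mate H x); first by case/and3P: (arch_label_ok aH xm).
rewrite -(arch_label aH).
by have := @arch_label_ok _ _ _ aH (mate H x); rewrite mateK => /(_ (ltnW mx))/and3P[].
Qed.

Lemma odd_lab H x : x <= mate H x -> odd (lab H x) = ~~ odd x.
Proof. by move=> /(arch_label_ok (okada_arch_system H))/and3P[_ _ /eqP]. Qed.

(** A half arc has no full arc above it, so the only arcs in which the half arc at [i]
is nested are the half arcs before it: lowering its label by 2 keeps all
conditions as soon as these have a smaller label. *)
Lemma lower_exists H i :
    mate H i = i -> 2 < lab H i ->
    (forall k, mate H k = k -> k < i -> lab H k < lab H i - 2) ->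
  exists K, [/\ lowering K H, mate K =1 mate H
              & forall x, lab K x = if x == i then lab H i - 2 else lab H x].
Proof.
move=> Hi li2 below; have aH := okada_arch_system H.
pose l x := if x == i then lab H i - 2 else lab H x.
have leH x : l x <= lab H x by rewrite /l; case: eqP => [->|//]; apply: leq_subr.
have aK : arch_system (mate H) l.
  split; [exact: mateK | exact: (arch_noncrossing aH) | | |].
  - by move=> x; rewrite /l -{1}Hi (inj_eq (inv_inj (@mateK _ H))) (arch_label aH).
  - move=> x xm; have /and3P[l0 lx ol] := arch_label_ok aH xm.
    apply/and3P; split; [|exact: leq_trans (leH x) lx|].
      by rewrite /l; case: eqP => // _; rewrite subn_gt0.
    rewrite /l -(eqP ol); have [->|//] := eqVneq x i.
    by rewrite oddB ?addbF // ltnW.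
  - move=> x y yf xy xh; have := arch_nested aH yf xy xh.
    rewrite [l y]/l; case: eqP => [ey _|_]; last exact: leq_ltn_trans.
    rewrite ey in xy xh *; rewrite /l ifN ?below //; last by rewrite -val_eqE ltn_eqF.
    by apply/eqP; case/orP: xh => //; rewrite (negPf (no_half_below_full Hi xy)).
exists (diagram aK); split; [|exact: mate_diagram|exact: lab_diagram].
exists i; split; first by rewrite halfE Hi.
- rewrite [RHS]arcs_orbits [LHS]arcs_orbits; apply: eq_imset => x.
  by rewrite mate_diagram.
- by rewrite lab_diagram /l eqxx subnK // ltnW.
- by move=> k ki; rewrite lab_diagram /l (negPf ki).
Qed.

(** The labels of half arcs increase strictly from left to right, so no half arc can
lie between two half arcs with consecutive labels: the new full arc
crosses nothing.  The arcs under it were nested in the half arc at [i], whose label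
it keeps, and those to its right lose a constraint. *)
Lemma glue_exists H i j :
    mate H i = i -> mate H j = j -> lab H j = (lab H i).+1 ->
  exists K, [/\ gluing K H,
      forall x, mate K x = if x == i then j else if x == j then i else mate H x
    & forall x, lab K x = if x == j then lab H i else lab H x].
Proof.
move=> Hi Hj lij; have aH := okada_arch_system H.
have ij : i < j.
  have [//|ji|/val_inj e] := ltngtP (i : nat) j.
    by have := half_lab_lt Hj Hi ji; rewrite lij ltnNge leqnSn.
  by move: lij; rewrite e => /n_Sn.
have nij : (i == j) = false by rewrite -val_eqE ltn_eqF.
have between c : i < c -> c < j -> mate H c != c.
  move=> ic cj; apply/eqP => Hc.
  by have := half_lab_lt Hc Hj cj; rewrite lij ltnS leqNgt (half_lab_lt Hi Hc ic).
pose f x := if x == i then j else if x == j then i else mate H x.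
pose l x := if x == j then lab H i else lab H x.
have fi : f i = j by rewrite /f eqxx.
have fj : f j = i by rewrite /f eq_sym nij eqxx.
have mateNhalf x k : mate H k = k -> x != k -> mate H x != k.
  by move=> Hk; rewrite -{2}Hk (inj_eq (inv_inj (@mateK _ H))).
have fN x : x != i -> x != j -> f x = mate H x by rewrite /f => /negPf-> /negPf->.
have fK : involutive f.
  move=> x; have [->|xi] := eqVneq x i; first by rewrite fi fj.
  have [->|xj] := eqVneq x j; first by rewrite fj fi.
  by rewrite (fN x) // fN ?mateK ?mateNhalf.
have lN x : x != j -> l x = lab H x by rewrite /l => /negPf->.
have aK : arch_system f l.
  split=> //.
  - move=> a c.
    have [->|ai] := eqVneq a i; last have [->|aj] := eqVneq a j.
    + rewrite fi => ac cj.
      have ci : c != i by rewrite -val_eqE gtn_eqF.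
      have cj' : c != j by rewrite -val_eqE ltn_eqF.
      rewrite fN // between //=; apply/andP; split.
        rewrite ltnNge leq_eqVlt val_eqE (negPf (mateNhalf _ _ Hi ci)) /=.
        by apply/negP => lt; have := no_half_below_full Hi lt; rewrite mateK ac.
      rewrite ltnNge leq_eqVlt eq_sym val_eqE (negPf (mateNhalf _ _ Hj cj')) /=.
      by apply/negP => lt; have := no_half_below_full Hj cj; rewrite lt.
    + by rewrite fj => ac ci; have := ltn_trans ij (ltn_trans ac ci); rewrite ltnn.
    + rewrite fN // => ac ca.
      have ci : c != i by apply: contraTneq ca => ci; rewrite ci in ac *; apply: no_half_below_full.
      have cj : c != j by apply: contraTneq ca => cj; rewrite cj in ac *; apply: no_half_below_full.
      by rewrite fN //; apply: (arch_noncrossing aH).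
  - move=> x; have [->|xi] := eqVneq x i; first by rewrite fi /l nij eqxx.
    have [->|xj] := eqVneq x j; first by rewrite fj /l nij eqxx.
    by rewrite fN // !lN ?mateNhalf // (arch_label aH).
  - move=> x; have [->|xi] := eqVneq x i.
      by rewrite lN ?nij // => _; apply: (arch_label_ok aH); rewrite Hi.
    have [->|xj] := eqVneq x j; first by rewrite fj leqNgt ij.
    by rewrite fN // lN //; apply: (arch_label_ok aH).
  - move=> x y.
    have [->|yi] := eqVneq y i; last have [->|yj] := eqVneq y j.
    + move=> _ xi; have xNi : x != i by rewrite -val_eqE ltn_eqF.
      have xNj : x != j by rewrite -val_eqE ltn_eqF // (ltn_trans xi).
      rewrite fN // !lN ?nij // => xh.
      by apply: (arch_nested aH); rewrite ?Hi.
    + by rewrite fj leqNgt ij.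
    + rewrite fN // (lN y) // => yf xy.
      have [xi|xi] := eqVneq x i.
        by rewrite xi lN ?nij // in xy * => _; apply: (arch_nested aH); rewrite ?Hi ?eqxx.
      have [xj|xj] := eqVneq x j; last by rewrite fN // lN //; apply: (arch_nested aH).
      rewrite xj fj nij /= in xy * => ylt.
      by have := ltn_trans ij (ltn_trans xy ylt); rewrite ltnn.
exists (diagram aK); split; [|exact: mate_diagram|exact: lab_diagram].
exists i, j; split; rewrite ?halfE ?Hi ?Hj //.
  apply/setP => A; rewrite arcs_orbits !inE; apply/imsetP/idP.
    case=> x _; rewrite mate_diagram => ->.
    have [->|xi] := eqVneq x i; first by rewrite fi eqxx.
    have [->|xj] := eqVneq x j; first by rewrite fj setUC eqxx.
    rewrite fN // mem_arcs andbT; apply/orP; right.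
    apply/andP; split; [apply: contraNneq xj | apply: contraNneq xi];
      by move=> /setP/(_ x); rewrite !inE eqxx.
  case/predU1P=> [->|/and3P[AnJ AnI AH]]; first by exists i; rewrite // mate_diagram fi.
  have [A0|[x xA]] := set_0Vmem A.
    by have /and3P[_ _ /negP[]] := arcs_partition H; rewrite -A0.
  exists x => //; rewrite mate_diagram; have eA := arc_mate AH xA.
  rewrite fN //; [apply: contraNneq AnI | apply: contraNneq AnJ] => ex;
    by rewrite eA ex ?Hi ?Hj setUid.
move=> k; rewrite lab_diagram !inE /l.
by have [->|//] := eqVneq k i; rewrite ?nij //=; case: eqP.
Qed.
End Moves.

Section Descent.

Variable N : nat.
Implicit Types (G H K : okada N) (a c x y i j k : 'I_N).

Definition down_move G H : Prop := gluing G H \/ lowering G H.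

(** All full arcs of [H] are in [G], so the other full arcs of [G] join half arcs of
[H]. *)
Lemma mate_half_half G H x :
  okada_le G H -> mate H x = x -> mate H (mate G x) = mate G x.
Proof.
move=> GH Hx; apply/eqP/negPn/negP => Hy; have [e _] := okada_le_full GH Hy.
have Gx : mate G x = x by rewrite -(mateK H (mate G x)) -e mateK.
by rewrite Gx Hx eqxx in Hy.
Qed.

Lemma le_lower G H K i :
    okada_le G H -> mate H i = i -> mate K =1 mate H ->
    (forall x, lab K x = if x == i then lab H i - 2 else lab H x) ->
    lab G i <= lab H i - 2 ->
  okada_le G K.
Proof.
move=> GH Hi mK lK lei; apply: okada_leI => x; rewrite mK ?lK => xH.
- by apply: (proj1 (okada_le_full GH _)); rewrite -val_eqE gtn_eqF.
- have -> : (x == i) = false by apply: contraTF xH => /eqP->; rewrite Hi ltnn.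
  by apply: (proj2 (okada_le_full GH _)); rewrite -val_eqE gtn_eqF.
- by case: eqP => [->//|_]; apply: okada_le_lab.
Qed.

Lemma le_glue G H K i j :
    okada_le G H -> i < j -> mate G i = j -> lab G i = lab H i ->
    (forall x, mate K x = if x == i then j else if x == j then i else mate H x) ->
    (forall x, lab K x = if x == j then lab H i else lab H x) ->
  okada_le G K.
Proof.
move=> GH ij Gi li mK lK.
have nij : (i == j) = false by rewrite -val_eqE ltn_eqF.
have full x : x < mate K x -> mate G x = mate K x /\ lab G x = lab K x.
  rewrite mK lK; have [->|xi] := eqVneq x i; first by rewrite nij.
  have [->|xj] := eqVneq x j; first by rewrite ltnNge ltnW.
  by move=> xH; apply: (okada_le_full GH); rewrite -val_eqE gtn_eqF.
apply: okada_leI => x; [by case/full | by case/full | move=> Kx].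
rewrite lK; case: eqP => [ex|_]; last exact: okada_le_lab.
by move: Kx; rewrite mK ex eqxx eq_sym nij => e; rewrite -e eqxx in nij.
Qed.

(** Look at the first node [i] where the labels differ; it is a half arc of [H].  If
[i] closes an arc of [G], the node [j] opening it is a half arc of [H] with the same
label, and it is the last one before [i]: glue [j] to [i] when the labels of [H] at
[j] and [i] are consecutive; otherwise they differ by at least 3, the
parities of [i] and [j] being distinct, and the label at [i] can be lowered.
If [i] does not close an arc of [G], its label differs by at least 2, by parity, and
can be lowered: an earlier half arc of [H] has kept its label and is, in [G], still a
half arc or the left end of a full arc reaching over [i], so that the arc of [G] at
[i] is nested in it and has a larger label. *)
Lemma exists_move G H :
  okada_le G H -> G <> H -> exists K, down_move K H /\ okada_le G K.
Proof.
move=> GH neGH; have aG := okada_arch_system G; have aH := okada_arch_system H.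
have [i [lti mini]] : exists i, lab G i < lab H i /\ forall k, k < i -> lab G k = lab H k.
  case: (pickP (fun x => lab G x < lab H x)) => [x0 x0P|none]; last first.
    case: neGH; apply: (okada_le_lab_eq GH) => x; apply/eqP.
    by rewrite eqn_leq okada_le_lab // leqNgt none.
  case: (@arg_minnP _ x0 (fun x => lab G x < lab H x) (fun x => x) x0P) => i iP imin.
  exists i; split=> // k ki; apply/eqP; rewrite eqn_leq okada_le_lab // leqNgt.
  by apply/negP => /imin; rewrite leqNgt ki.
have Hi : mate H i = i.
  by apply/eqP/negPn/negP => /(okada_le_full GH)[_ e]; rewrite e ltnn in lti.
(* Before [i], the half arcs of [H] do not change label, so no two are glued in [G]. *)
have open k : mate H k = k -> k < i -> mate G k = k \/ i <= mate G k.
  move=> Hk ki; have [|mi] := leqP i (mate G k); [by right | left].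
  have Hm := mate_half_half GH Hk.
  have e : lab H k = lab H (mate G k).
    by rewrite -!mini // (arch_label aG).
  have [lt|lt|/val_inj //] := ltngtP (mate G k : nat) k.
  - by have := half_lab_lt Hm Hk lt; rewrite e ltnn.
  - by have := half_lab_lt Hk Hm lt; rewrite e ltnn.
have lower : (forall k, mate H k = k -> k < i -> lab H k < lab H i - 2) ->
    lab G i <= lab H i - 2 -> exists K, down_move K H /\ okada_le G K.
  move=> below lei; have l0 := lab_gt0 G i.
  have [|K [KH mK lK]] := lower_exists Hi _ below; first by lia.
  by exists K; split; [right | apply: (le_lower GH Hi mK lK)].
have [mi|im] := ltnP (mate G i) i; last first.
  have lei : lab G i <= lab H i - 2.
    have := odd_lab im; have := @odd_lab _ H i; rewrite Hi leqnn => /(_ isT).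
    by lia.
  apply: lower => // k Hk ki; apply: leq_trans lei; rewrite -mini //.
  apply: (arch_nested aG) => //.
  have [->|ik] := open k Hk ki; first by rewrite eqxx.
  rewrite [i < _]ltn_neqAle ik andbT val_eqE orbC; apply/orP; left.
  by apply: contraTneq im => e; rewrite {2}e mateK -ltnNge.
set j := mate G i in mi.
have Gj : mate G j = i by rewrite mateK.
have Hj : mate H j = j by apply: mate_half_half.
have lj : lab G i = lab H j by rewrite -mini // /j (arch_label aG).
have ltji := half_lab_lt Hj Hi mi.
have oddij : odd i = ~~ odd j by rewrite -Gj (arch_parity aG) ?Gj.
have := @odd_lab _ H i; rewrite Hi leqnn => /(_ isT) oi.
have := @odd_lab _ H j; rewrite Hj leqnn => /(_ isT) oj.
have [e|ne] := eqVneq (lab H i) (lab H j).+1.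
  have [K [KH mK lK]] := glue_exists Hj Hi e.
  exists K; split; first by left.
  by apply: (le_glue GH mi Gj _ mK lK); rewrite mini.
have lt3 : lab H j < lab H i - 2 by lia.
apply: lower; last by rewrite lj ltnW.
move=> k Hk ki; apply: leq_ltn_trans lt3.
have [kj|jk|/val_inj -> //] := ltngtP (k : nat) j.
  by rewrite ltnW // half_lab_lt.
have := arch_noncrossing aG jk; rewrite Gj => /(_ ki)/andP[Gk /andP[_ mk]].
have [e|] := open k Hk ki; first by rewrite e eqxx in Gk.
by rewrite leqNgt mk.
Qed.

Lemma gluing_le G H : gluing G H -> okada_le G H.
Proof.
case=> i [j [hi hj lij aG lG]]; rewrite !halfE in hi hj.
have lGle k : lab G k <= lab H k.
  by rewrite lG !inE; do 2?[case: eqP => [->|_] //=]; rewrite lij.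
have notij a : a != mate H a -> a \notin [set i; j].
  by rewrite eq_sym !inE; apply: contraNN => /orP[]/eqP->.
split=> // a b; rewrite fullE => /andP[ab /eqP e].
have nea : a != mate H a by rewrite e -val_eqE ltn_eqF.
rewrite lG (negPf (notij _ nea)); split=> //.
rewrite /full /full_arc ab aG -e !inE mem_arcs andbT /=.
have card2 : #|[set a; mate H a]| = 2 by rewrite cards2 nea.
by apply/orP; right; apply/andP; split; apply/eqP => eq1; move: card2; rewrite eq1 cards1.
Qed.

Lemma lowering_le G H : lowering G H -> okada_le G H.
Proof.
case=> i [hi aG li lG]; split=> [a b|a _]; last first.
  by have [->|/lG->//] := eqVneq a i; rewrite li leq_addr.
rewrite {2}/full aG => ab; split=> //; apply: lG; apply: contraTneq ab => ->.
by rewrite fullE; rewrite halfE in hi; rewrite (eqP hi) andbC; case: eqP => // ->; rewrite ltnn.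
Qed.

Lemma move_le G H : down_move G H -> okada_le G H.
Proof. by case; [apply: gluing_le | apply: lowering_le]. Qed.

End Descent.

(** * Covers and rank *)

Section Rank.

Variable N : nat.
Implicit Types (G H K L : okada N) (a c x y i j k : 'I_N).

Lemma lab_le H x : lab H x <= x.+1.
Proof. by apply: leq_trans (okada_le_lab x (okada_le_top H)) _; rewrite /lab ffunE. Qed.

Lemma NP_openers H : NP H = #|[set x : 'I_N | x < mate H x]|.
Proof.
rewrite /NP -(@card_in_imset _ _ (fun x : 'I_N => [set x; mate H x])).
  apply: eq_card => A; rewrite inE arcs_orbits; apply/andP/imsetP.
    case=> /imsetP[x _ ->]; rewrite cards2.
    have [xm _|mx _|/val_inj <-] := ltngtP (x : nat) (mate H x); last by rewrite eqxx.
      by exists x; rewrite ?inE.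
    by exists (mate H x); rewrite ?inE mateK // setUC.
  case=> x; rewrite inE => xm ->; split; first exact: imset_f.
  have nx : x != mate H x by rewrite -val_eqE ltn_eqF.
  by rewrite cards2 nx.
move=> x y; rewrite !inE => xm ym /setP/(_ x); rewrite !inE eqxx /=.
case: eqP => [//|_ /esym/eqP ex].
by move: xm; rewrite ex mateK ltnNge ltnW.
Qed.

Lemma NP_half H : 2 * NP H + #|[set x | mate H x == x]| = N.
Proof.
have := card_involution (@mateK _ H) (S := setT) (fun x _ => in_setT _).
rewrite cardsT card_ord NP_openers => eN; apply: etrans (esym eN).
by congr (2 * _ + _); apply: eq_card => x; rewrite !inE.
Qed.

(** Twice the rank in the dual poset.  The truncated subtraction is exact by
[lab_le]. *)
Definition twice_rank H : nat := NP H + \sum_(i < N) (i.+1 - lab H i).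

Lemma twice_rank_top : twice_rank (okada_top N) = 0.
Proof.
rewrite /twice_rank big1 => [|i _]; last by rewrite /lab ffunE subnn.
have := NP_half (okada_top N).
rewrite (_ : [set x | _] = setT) ?cardsT ?card_ord; first by lia.
by apply/setP => x; rewrite !inE -halfE; apply: imset_f.
Qed.

Lemma sum_lab_change G H i m :
    (forall k, k != i -> lab G k = lab H k) -> lab H i = lab G i + m ->
  \sum_(k < N) (k.+1 - lab G k) = \sum_(k < N) (k.+1 - lab H k) + m.
Proof.
move=> eqN eqi; rewrite (bigD1 i) // [in RHS](bigD1 i) //= addnAC.
congr (_ + _); last by apply: eq_bigr => k ki; rewrite eqN.
by have := lab_le H i; rewrite eqi; lia.
Qed.

Lemma NP_gluing G H i j :
    half H i -> half H j -> i != j ->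
    arcs G = [set i; j] |: (arcs H :\ [set i] :\ [set j]) ->
  NP G = (NP H).+1.
Proof.
rewrite !halfE => /eqP Hi /eqP Hj ij aG; rewrite /NP.
rewrite (_ : [set A in arcs G | _] = [set i; j] |: [set A in arcs H | #|A| == 2]).
  rewrite cardsU1 inE; have [ijH|//] := boolP ([set i; j] \in arcs H).
  have := arc_mate ijH (set21 i j).
  by rewrite Hi setUid => /setP/(_ j); rewrite !inE eqxx orbT eq_sym (negPf ij).
apply/setP => A; rewrite aG !inE.
have [->|_] := eqVneq A [set i; j]; first by rewrite cards2 ij.
have [->|_] := eqVneq A [set j]; first by rewrite cards1 !andbF.
by have [->|] := eqVneq A [set i]; first by rewrite cards1 !andbF.
Qed.

Lemma twice_rank_move G H : down_move G H -> twice_rank G = twice_rank H + 2.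
Proof.
rewrite /twice_rank; case=> [[i [j [hi hj lij aG lG]]]|[i [hi aG li lG]]].
  have ij : i != j by apply: contra_eqN lij => /eqP->; rewrite ltn_eqF.
  rewrite (NP_gluing hi hj ij aG) (@sum_lab_change G H j 1); first by lia.
    move=> k kj; rewrite lG !inE (negPf kj) orbF.
    by case: eqP => [->|].
  by rewrite lG !inE eqxx orbT addn1.
by rewrite (sum_lab_change lG li) /NP aG addnA.
Qed.

Lemma sum_ord_double n : 2 * \sum_(i < n) i = n * n.-1.
Proof.
elim: n => [|n IH]; first by rewrite big_ord0.
by rewrite big_ord_recr /= mulnDr IH; case: n {IH} => //; lia.
Qed.

Lemma twice_rank_le H : 2 * twice_rank H <= N ^ 2.
Proof.
have le_sum : \sum_(i < N) (i.+1 - lab H i) <= \sum_(i < N) i.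
  by apply: leq_sum => i _; have := lab_gt0 H i; lia.
have := NP_half H; have := sum_ord_double N; rewrite /twice_rank.
have -> : N ^ 2 = N + N * N.-1 by case: (N) => // n; rewrite -mulnn; lia.
by lia.
Qed.

(** Induction down from [H] to any [G <= H], one move at a time; it terminates because
[twice_rank] grows along moves and is bounded. *)
Lemma move_ind (P : okada N -> Prop) G H :
  (forall K L, down_move K L -> P L -> P K) -> okada_le G H -> P H -> P G.
Proof.
move=> PM; have [n] : exists n, N ^ 2 < 2 * twice_rank H + n by exists (N ^ 2).+1; lia.
elim: n H => [|n IH] H ltn GH PH.
  by have := twice_rank_le H; lia.
have [-> //|/eqP neGH] := eqVneq G H.
have [K [KH GK]] := exists_move GH neGH.
apply: (IH K) => //; first by have := twice_rank_move KH; lia.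
exact: PM KH PH.
Qed.

Lemma twice_rank_le_eq G H :
  okada_le G H -> G = H \/ twice_rank H + 2 <= twice_rank G.
Proof.
move=> GH; have [-> |/eqP neGH] := eqVneq G H; [by left | right].
have [K [KH GK]] := exists_move GH neGH.
have := twice_rank_move KH => <-.
apply: (move_ind (P := fun L => twice_rank K <= twice_rank L)) GK _ => // L M LM.
by have := twice_rank_move LM; lia.
Qed.

(** A strict inequality changes [twice_rank] by at least 2, so a move, which changes it
by exactly 2, leaves no room for an intermediate diagram. *)
Lemma covers_move G H : covers (@okada_le N) G H <-> down_move G H.
Proof.
split=> [[[GH neGH] noK]|GH].
  have [K [KH GK]] := exists_move GH neGH.
  have [-> //|/eqP neGK] := eqVneq G K.
  case: noK; exists K; split; split=> //; first exact: move_le.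
  by move=> e; have := twice_rank_move KH; rewrite e; lia.
have rGH := twice_rank_move GH.
split; first by split; [apply: move_le | move=> e; rewrite e in rGH; lia].
case=> K [[GK neGK] [KH neKH]].
case: (twice_rank_le_eq GK) => // lt1; case: (twice_rank_le_eq KH) => // lt2.
by lia.
Qed.

Lemma okada_ranked : ranked (@okada_le N).
Proof.
exists (fun H => - (twice_rank H %/ 2)%N%:Z)%R => G H /covers_move/twice_rank_move ->.
by rewrite divnDr // divnn /= PoszD; lia.
Qed.

Lemma rank_function_twice rk :
    rank_function (dual_rel (@okada_le N)) rk -> rk (okada_top N) = 0%R ->
  forall H, (2 * rk H = (twice_rank H)%:Z)%R.
Proof.
move=> rkP rk0 H.
apply: (move_ind (P := fun L => (2 * rk L = (twice_rank L)%:Z)%R)) (okada_le_top H) _.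
  move=> K L KL; rewrite (twice_rank_move KL).
  have [[LK neLK] noM] := proj2 (covers_move K L) KL.
  rewrite (rkP L K); first by lia.
  split; first by split=> // /esym.
  by case=> M [[LM neLM] [MK neMK]]; apply: noM; exists M; split; split=> // /esym.
by rewrite rk0 twice_rank_top.
Qed.

End Rank.

(** * The maximal rank *)

Section Extremal.

Variable N : nat.

(** The element [x] stands for node [x.+1], so the pairs of nodes {1, 2}, {3, 4} and so
on start at even [x]; the default value of [insubd] leaves the last node alone
when it has no successor. *)
Definition adjacent_node (x : 'I_N) : 'I_N := insubd x (if odd x then x.-1 else x.+1).

Lemma adjacent_nodeE x : adjacent_node x =
  (if odd x then x.-1 else if x.+1 < N then x.+1 else x) :> nat.
Proof.
rewrite val_insubd; have := ltn_ord x.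
by case: (odd x) => // xN; case: ifP; lia.
Qed.

Lemma adjacent_arch_system : arch_system adjacent_node (fun=> 1).
Proof.
split=> //.
- move=> x; apply: val_inj => /=.
  rewrite !adjacent_nodeE; have := ltn_ord x.
  by do !case: ifP; lia.
- by move=> a c; rewrite (adjacent_nodeE a); do !case: ifP; lia.
- move=> x; rewrite adjacent_nodeE /label_ok /=.
  by do !case: ifP; case: (x : nat) => //=; lia.
- move=> x y _ xy; rewrite -val_eqE /= adjacent_nodeE; have := ltn_ord y.
  by do !case: ifP; lia.
Qed.

(** The error term is the number of unpaired nodes, which is 1 when [N] is odd. *)
Lemma twice_rank_adjacent :
  N ^ 2 <= 2 * twice_rank (diagram adjacent_arch_system) + 1.
Proof.
set B := diagram _; have := NP_half B; rewrite /twice_rank.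
have : #|[set x | mate B x == x]| <= 1.
  apply/card_le1_eqP => x y; rewrite !inE !mate_diagram -!val_eqE /= !adjacent_nodeE.
  move=> hx hy; apply: val_inj => /=; move: hx hy; have := ltn_ord x; have := ltn_ord y.
  by do !case: ifP; lia.
have -> : \sum_(i < N) (i.+1 - lab B i) = \sum_(i < N) i.
  by apply: eq_bigr => i _; rewrite lab_diagram subn1.
have := sum_ord_double N.
have -> : N ^ 2 = N + N * N.-1 by case: (N) => // n; rewrite -mulnn; lia.
by lia.
Qed.

End Extremal.

Local Open Scope ring_scope.

Theorem proposition5p22 (N : nat) :
  [/\ join_semilattice (@okada_le N),
      ranked (@okada_le N),
      forall G H : okada N,
        covers (@okada_le N) G H <-> gluing G H \/ lowering G H,
      forall H : okada N, okada_le H (okada_top N)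
    & forall rk : okada N -> int,
        rank_function (dual_rel (@okada_le N)) rk ->
        rk (okada_top N) = 0 ->
        (forall H : okada N,
           (rk H)%:~R =
             2^-1 * ((NP H)%:R
                     + \sum_(i < N) ((i.+1)%:R - (lab H i)%:R)) :> rat)
        /\ (forall H : okada N, rk H <= (N ^ 2 %/ 4)%N%:Z)
        /\ (exists H : okada N, rk H = (N ^ 2 %/ 4)%N%:Z)].
Proof.
split.
- exact: okada_join_semilattice.
- exact: okada_ranked.
- exact: covers_move.
- exact: okada_le_top.
move=> rk rkP rk0; have twice := rank_function_twice rkP rk0.
split; [|split] => [H|H|].
- have -> : (NP H)%:R + \sum_(i < N) ((i.+1)%:R - (lab H i)%:R) = (2 * rk H)%:~R :> rat.
    rewrite twice /twice_rank -pmulrn natrD natr_sum; congr (_ + _).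
    by apply: eq_bigr => i _; rewrite natrB ?lab_le.
  by rewrite intrM mulrA mulVf ?mul1r.
- by have := twice H; have := twice_rank_le H; lia.
- exists (diagram (@adjacent_arch_system N)); set B := diagram _.
  have := twice B; have := twice_rank_le B; have := twice_rank_adjacent N.
  by rewrite -/B; lia.
Qed.
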